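(* Let $D$ be an integral domain and let $\Theta$ be a Jaffard family of $D$. Then there is an exact sequence $$0\longrightarrow\mathrm{Pic}(D)\longrightarrow\mathrm{Pic}(\mathrm{Int}(D))\longrightarrow\bigoplus_{T\in\Theta}\mathrm{Pic}_{\mathrm{Int}}(T)\longrightarrow 0.$$ In particular, $\mathrm{Pic}_{\mathrm{Int}}(D)\simeq\bigoplus_{T\in\Theta}\mathrm{Pic}_{\mathrm{Int}}(T)$.
   Context: $D$ is an integral domain with quotient field $K$; for a domain $A$ with quotient field $K$, $\mathrm{Int}(A)=\{f\in K[X]\mid f(A)\subseteq A\}$, and $\mathrm{Pic}(A)$ is the group of invertible fractional ideals of $A$ modulo principal fractional ideals. Let $\iota_A:\mathrm{Pic}(A)\to\mathrm{Pic}(\mathrm{Int}(A))$, $[I]\mapsto[I\,\mathrm{Int}(A)]$ be the canonical (injective) extension map, and define the int-polynomial Picard group $\mathrm{Pic}_{\mathrm{Int}}(A):=\mathrm{Pic}(\mathrm{Int}(A))/\iota_A(\mathrm{Pic}(A))$. An overring is a ring between $D$ and $K$; it is flat if it is flat as a $D$-module. A family $\Theta$ of overrings of $D$ is a pre-Jaffard family if: either $\Theta=\{K\}$ or $K\notin\Theta$; every $T\in\Theta$ is flat over $D$; $\Theta$ is complete (every ideal $I$ of $D$ satisfies $I=\bigcap_{T\in\Theta}IT$); $\Theta$ is independent ($TT'=K$ for $T\neq T'$ in $\Theta$); and $\Theta$ is compact in the Zariski topology of the set of overrings of $D$ (subbasic open sets $\{T\mid x_1,\dots,x_n\in T\}$,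 $x_i\in K$). A Jaffard family is a pre-Jaffard family that is locally finite: every nonzero $x\in D$ is a nonunit in only finitely many $T\in\Theta$. *)

(* Defs.v *)
From HB Require Import structures.
From mathcomp Require Import all_boot all_order all_algebra fraction.
From Stdlib Require List.
Set Implicit Arguments. Unset Strict Implicit. Unset Printing Implicit Defensive.
Import GRing.Theory.
Local Open Scope ring_scope.

Definition lset (L : Type) := L -> Prop.

Section Generic.
Variable L : fieldType.

Definition is_subring (A : lset L) : Prop :=
  [/\ A 0, A 1, (forall x y, A x -> A y -> A (x - y)) &
      (forall x y, A x -> A y -> A (x * y))].

(* The product I J = set of finite sums of products a*b, a in I, b in J.
   Used for products of (fractional) ideals, for extensions I S of ideals
   to overrings, and for the compositum T T' of two overrings. *)
Definition prodset (I J : lset L) : lset L := fun x =>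
  exists s : seq (L * L),
    (forall p, p \in s -> I p.1 /\ J p.2) /\ x = \sum_(p <- s) p.1 * p.2.

Definition set_eq (I J : lset L) : Prop := forall x, I x <-> J x.

Definition frac_ideal (R I : lset L) : Prop :=
  [/\ I 0, (forall x y, I x -> I y -> I (x + y)),
      (forall r x, R r -> I x -> I (r * x)),
      (exists x, I x /\ x <> 0) &
      (exists d, [/\ R d, d <> 0 & forall x, I x -> R (d * x)])].

Definition invertible (R I : lset L) : Prop :=
  frac_ideal R I /\ exists J, frac_ideal R J /\ set_eq (prodset I J) R.

Definition scale_set (u : L) (J : lset L) : lset L := fun x =>
  exists y, J y /\ x = u * y.

Definition pic_eq (I J : lset L) : Prop :=
  exists u, u <> 0 /\ set_eq I (scale_set u J).

Definition unit_in (T : lset L) (x : L) : Prop := exists y, T y /\ x * y = 1.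

Definition ideal_of (D I : lset L) : Prop :=
  [/\ (forall x, I x -> D x), I 0, (forall x y, I x -> I y -> I (x + y)) &
      (forall r x, D r -> I x -> I (r * x))].

(* flatness of a submodule T of L (with D-action by multiplication), via the
   equational criterion for flatness: every linear relation sum a_i m_i = 0
   (a_i in D, m_i in T) is trivial. *)
Definition flat_over (D T : lset L) : Prop :=
  forall (n : nat) (a m : 'I_n -> L),
    (forall i, D (a i)) -> (forall i, T (m i)) ->
    \sum_i a i * m i = 0 ->
    exists (k : nat) (b : 'I_n -> 'I_k -> L) (y : 'I_k -> L),
      [/\ (forall i j, D (b i j)), (forall j, T (y j)),
          (forall i, m i = \sum_j b i j * y j) &
          (forall j, \sum_i a i * b i j = 0)].

End Generic.

Section Domain.
Variable K : fieldType.

Definition domain_with_qf (D : lset K) : Prop :=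
  is_subring D /\ forall x, exists a b, [/\ D a, D b, b <> 0 & x = a / b].

Definition overring (D T : lset K) : Prop :=
  is_subring T /\ forall x, D x -> T x.

(* open subsets of the space of overrings (Zariski topology generated by
   the subbasic sets {T | x_1, ..., x_n in T}) *)
Definition zariski_open (D : lset K) (U : lset K -> Prop) : Prop :=
  forall T, overring D T -> U T ->
    exists xs : seq K, (forall x, x \in xs -> T x) /\
      forall T', overring D T' -> (forall x, x \in xs -> T' x) -> U T'.

Definition zariski_compact (D : lset K) (Theta : lset K -> Prop) : Prop :=
  forall (I : Type) (U : I -> lset K -> Prop),
    (forall i, zariski_open D (U i)) ->
    (forall T, Theta T -> exists i, U i T) ->
    exists s : list I, forall T, Theta T -> exists i, List.In i s /\ U i T.

Definition fullK : lset K := fun _ => True.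

Definition pre_jaffard (D : lset K) (Theta : lset K -> Prop) : Prop :=
  [/\ (Theta fullK -> forall T, Theta T -> T = fullK),
      (forall T, Theta T -> overring D T /\ flat_over D T),
      (forall I, ideal_of D I ->
         forall x, I x <-> (forall T, Theta T -> prodset I T x)),
      (forall T T', Theta T -> Theta T' -> T <> T' -> set_eq (prodset T T') fullK) &
      zariski_compact D Theta].

Definition jaffard (D : lset K) (Theta : lset K -> Prop) : Prop :=
  pre_jaffard D Theta /\
  forall x, D x -> x <> 0 ->
    exists s : list (lset K), forall T, Theta T -> ~ unit_in T x -> List.In T s.

Definition int_poly (A : lset K) (f : {poly K}) : Prop :=
  forall a, A a -> A f.[a].

Notation KX := {fraction {poly K}}.

Definition IntR (A : lset K) : lset KX := fun z =>
  exists f : {poly K}, int_poly A f /\ z = FracField.tofrac f.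

Definition embK (I : lset K) : lset KX := fun z =>
  exists a, I a /\ z = FracField.tofrac (a%:P).

Definition iota_int (A I : lset K) : lset KX := prodset (embK I) (IntR A).

(* the class of J in Pic(Int(A)) lies in iota_A(Pic(A)),
   i.e. [J] = 0 in Pic_Int(A) *)
Definition in_im_iota (A : lset K) (J : lset KX) : Prop :=
  exists I, invertible A I /\ pic_eq J (iota_int A I).

(* [J1] = [J2] in Pic_Int(A) = Pic(Int(A)) / iota_A(Pic(A)) *)
Definition picInt_eq (A : lset K) (J1 J2 : lset KX) : Prop :=
  exists I, invertible A I /\ pic_eq J1 (prodset J2 (iota_int A I)).

End Domain.

(* Main.v *)
(* Write L_T for an extension of L to T.  A flat overring T satisfies
   (D :_D t) T = T for t in T, and independence adds (x T' :&: D) T = T for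
   distinct members T, T' and x <> 0.  So D is dense in each T, whence
   Int(D) is contained in Int(T); by local finiteness, finitely many
   prescribed modules can be glued over D without changing their extensions,
   whence Int(D) T = Int(T).

   An invertible J over Int(A) becomes, after dividing by a generator of
   J K[X], a module of polynomials which contains a nonzero constant, as does
   its inverse.  The constants are units in almost all T, so J Int(T) is almost
   everywhere principal.  If J is locally extended from ideals, it is globally
   extended from the ideal of its constants.  Surjectivity is obtained by
   gluing normal forms of the prescribed classes, and of their inverses. *)

Require Import Defs.
From HB Require Import structures.
From mathcomp Require Import all_boot all_order all_algebra fraction.
From mathcomp Require Import ring boolp.
From Stdlib Require List.

Set Implicit Arguments. Unset Strict Implicit. Unset Printing Implicit Defensive.
Import GRing.Theory.
Local Open Scope ring_scope.

Lemma lsetP (L : Type) (A B : lset L) : (forall x, A x <-> B x) -> A = B.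
Proof. by move=> AB; apply/predeqP. Qed.

(** * Products, scalings and invertible ideals as subsets of a field *)

Section SetAlgebra.
Variable L : fieldType.
Implicit Types (A B I J M N : lset L) (u v x y : L).

Definition add_closed M := M 0 /\ forall x y, M x -> M y -> M (x + y).

Definition is_module A M := add_closed M /\ forall a x, A a -> M x -> M (a * x).

Lemma add_closed_sum M (I : Type) (r : seq I) (P : pred I) (F : I -> L) :
  add_closed M -> (forall i, P i -> M (F i)) -> M (\sum_(i <- r | P i) F i).
Proof. by move=> [M0 MD] MF; apply: big_ind. Qed.

Lemma prodset_ind I J (P : L -> Prop) : add_closed P ->
  (forall a b, I a -> J b -> P (a * b)) -> forall x, prodset I J x -> P x.
Proof.
move=> Pc PIJ x [s [+ ->]]; elim: s => [|p s IHs] IJs.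
  by rewrite big_nil; case: Pc.
rewrite big_cons; apply: (Pc).2.
  by have [] := IJs p (mem_head _ _); apply: PIJ.
by apply: IHs => q qs; apply: IJs; rewrite inE qs orbT.
Qed.

Lemma prodset_mem I J a b : I a -> J b -> prodset I J (a * b).
Proof.
move=> Ia Jb; exists [:: (a, b)]; rewrite big_seq1; split=> // p.
by rewrite inE => /eqP->.
Qed.

Lemma prodset_add_closed I J : add_closed (prodset I J).
Proof.
split; first by exists [::]; rewrite big_nil.
move=> x y [s [IJs ->]] [t [IJt ->]]; exists (s ++ t); rewrite big_cat; split=> // p.
by rewrite mem_cat => /orP[/IJs|/IJt].
Qed.

Lemma prodsetC I J : prodset I J = prodset J I.
Proof.
have sub A B x : prodset A B x -> prodset B A x.
  apply: prodset_ind; first exact: prodset_add_closed.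
  by move=> a b Aa Bb; rewrite mulrC; apply: prodset_mem.
by apply: lsetP => x; split; apply: sub.
Qed.

(** The fixed factor [u] lets a product of several sets be unfolded one factor at a time. *)
Lemma prodset_mul_closed I J M : add_closed M -> forall u,
  (forall a b, I a -> J b -> M (u * (a * b))) ->
  forall x, prodset I J x -> M (u * x).
Proof.
move=> [M0 MD] u MIJ; apply: prodset_ind => //; split; first by rewrite mulr0.
by move=> x y Mx My; rewrite mulrDr; apply: MD.
Qed.

Lemma prodsetA I J M : prodset I (prodset J M) = prodset (prodset I J) M.
Proof.
apply: lsetP => x; split; apply: prodset_ind (prodset_add_closed _ _) _ _.
  move=> a b Ia; apply: prodset_mul_closed; first exact: prodset_add_closed.
  by move=> j m Jj Mm; rewrite mulrA; do 2!apply: prodset_mem => //.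
move=> a b + Mb; rewrite mulrC; move: a.
apply: prodset_mul_closed; first exact: prodset_add_closed.
move=> i j Ii Jj; have -> : b * (i * j) = i * (j * b) by ring.
by do 2!apply: prodset_mem => //.
Qed.

Lemma prodset_module A M : is_module A M -> A 1 -> prodset M A = M.
Proof.
move=> [Mc MA] A1; apply: lsetP => x; split.
  by apply: prodset_ind => // m a Mm Aa; rewrite mulrC; apply: MA.
by move=> Mx; rewrite -[x]mulr1; apply: prodset_mem.
Qed.

Lemma is_module_prod A I J : is_module A J -> is_module A (prodset I J).
Proof.
move=> [_ AJ]; split; first exact: prodset_add_closed.
move=> a x Aa; move: x; apply: prodset_mul_closed; first exact: prodset_add_closed.
by move=> i j Ii Jj; rewrite mulrCA; apply: prodset_mem => //; apply: AJ.
Qed.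

Lemma is_module_sub A B M : (forall x, A x -> B x) -> is_module B M -> is_module A M.
Proof. by move=> AB [Mc MB]; split=> // a x Aa; apply/MB/AB. Qed.

Lemma subring_add_closed A : is_subring A -> add_closed A.
Proof.
move=> [A0 A1 AB AM]; split=> // x y Ax Ay.
by rewrite -[y]opprK; apply: (AB) => //; rewrite -sub0r; apply: AB.
Qed.

Lemma subring_module A : is_subring A -> is_module A A.
Proof. by move=> Ar; split; [apply: subring_add_closed | case: Ar]. Qed.

Lemma subring_opp A x : is_subring A -> A x -> A (- x).
Proof. by move=> [A0 _ AB _] Ax; rewrite -sub0r; apply: AB. Qed.

Lemma frac_ideal_module A I : frac_ideal A I -> is_module A I.
Proof. by case. Qed.

Lemma frac_ideal_self A : is_subring A -> frac_ideal A A.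
Proof.
move=> Ar; have [Ac AM] := subring_module Ar; have [_ A1 _ _] := Ar.
by case: (Ac); split=> //; exists 1; split=> //;
  [apply/eqP/oner_neq0 | apply/eqP/oner_neq0 | move=> x; rewrite mul1r].
Qed.

Lemma invertible_self A : is_subring A -> invertible A A.
Proof.
move=> Ar; split; first exact: frac_ideal_self.
exists A; split; first exact: frac_ideal_self.
by rewrite (prodset_module (subring_module Ar)) //; case: Ar.
Qed.

Lemma scale1_set I : scale_set 1 I = I.
Proof.
apply: lsetP => x; split=> [[y [Iy ->]]|Ix]; first by rewrite mul1r.
by exists x; rewrite mul1r.
Qed.

Lemma scale_scale_set u v I : scale_set u (scale_set v I) = scale_set (u * v) I.
Proof.
apply: lsetP => x; split=> [[_ [[y [Iy ->]] ->]]|[y [Iy ->]]].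
  by exists y; rewrite mulrA.
by exists (v * y); rewrite mulrA; split=> //; exists y.
Qed.

Lemma scale_set_prod u I J : prodset (scale_set u I) J = scale_set u (prodset I J).
Proof.
apply: lsetP => x; split.
  apply: prodset_ind.
    have [P0 PD] := prodset_add_closed I J.
    split; first by exists 0; rewrite mulr0.
    move=> _ _ [a [Ia ->]] [b [Jb ->]]; exists (a + b); rewrite mulrDr.
    by split=> //; apply: PD.
  move=> _ b [a [Ia ->]] Jb; exists (a * b); rewrite mulrA; split=> //.
  exact: prodset_mem.
move=> [y [+ ->]]; move: y; apply: prodset_mul_closed; first exact: prodset_add_closed.
by move=> a b Ia Jb; rewrite mulrA; apply: prodset_mem => //; exists a.
Qed.

Lemma scale_set_module A u M : is_module A M -> is_module A (scale_set u M).
Proof.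
move=> [[M0 MD] MA]; split.
  split; first by exists 0; rewrite mulr0.
  by move=> _ _ [a [Ia ->]] [b [Jb ->]]; exists (a + b); rewrite mulrDr; split; auto.
by move=> a _ Aa [x [Mx ->]]; exists (a * x); rewrite mulrCA; split; auto.
Qed.

Lemma scale_setK u I : u != 0 -> scale_set u (scale_set u^-1 I) = I.
Proof. by move=> u0; rewrite scale_scale_set divff ?scale1_set. Qed.

Lemma set_eqE I J : set_eq I J -> I = J.
Proof. exact: lsetP. Qed.

Lemma pic_eqP I J : pic_eq I J <-> exists u, u != 0 /\ I = scale_set u J.
Proof.
split=> [[u [/eqP u0 /set_eqE IJ]]|[u [/eqP u0 ->]]]; first by exists u.
by exists u.
Qed.

Lemma frac_ideal_extend A B I : is_subring A -> is_subring B ->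
  (forall x, A x -> B x) -> frac_ideal A I -> frac_ideal B (prodset I B).
Proof.
move=> Ar Br AB [I0 ID IA [x [Ix x0]] [d [Ad d0 dI]]].
have [[P0 PD] PB] := is_module_prod I (subring_module Br).
have [_ B1 _ BM] := Br.
split=> //.
  by exists x; split=> //; rewrite -[x]mulr1; apply: prodset_mem.
exists d; split=> //; first exact: AB.
apply: prodset_mul_closed; first exact: subring_add_closed.
by move=> a b Ia Bb; rewrite mulrA; apply: BM => //; apply/AB/dI.
Qed.

Lemma invertible_extend A B I : is_subring A -> is_subring B ->
  (forall x, A x -> B x) -> invertible A I -> invertible B (prodset I B).
Proof.
move=> Ar Br AB [If [J [Jf /set_eqE IJ]]].
split; first exact: frac_ideal_extend If.
exists (prodset J B); split; first exact: frac_ideal_extend Jf.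
have [_ A1 _ _] := Ar; have [_ B1 _ BM] := Br.
have BB : prodset B B = B by apply: prodset_module B1; apply: subring_module.
rewrite [prodset J B]prodsetC prodsetA -[prodset (prodset I B) B]prodsetA BB.
rewrite -prodsetA [prodset B J]prodsetC prodsetA IJ prodsetC.
rewrite prodset_module //; apply: is_module_sub AB _; exact: subring_module.
Qed.

Lemma invertible_inverse A I : invertible A I ->
  exists J, invertible A J /\ prodset I J = A.
Proof.
move=> [If [J [Jf IJ]]]; exists J; split; last exact: set_eqE.
by split=> //; exists I; split=> //; rewrite prodsetC.
Qed.

End SetAlgebra.

Lemma exists_min (T : Type) (P : T -> Prop) (f : T -> nat) : (exists x, P x) ->
  exists x, P x /\ forall y, P y -> (f x <= f y)%N.
Proof.
move=> [x Px]; have [n] := ubnP (f x); elim: n x Px => // n IHn x Px lt_fx.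
have [[y [Py lt_yx]]|min] := EM (exists y, P y /\ (f y < f x)%N).
  by apply: (IHn y Py); apply: leq_trans lt_yx _.
exists x; split=> // y Py; rewrite leqNgt; apply/negP => lt_yx.
by apply: min; exists y.
Qed.

Local Notation "p %:F" := (FracField.tofrac p).

(** Naming this composite lets it carry the ring morphism structure declared next. *)
Definition emb (K : fieldType) (a : K) : {fraction {poly K}} := a%:P%:F.

HB.instance Definition _ (K : fieldType) :=
  GRing.RMorphism.copy (@emb K) (@FracField.tofrac {poly K} \o @polyC K).

Lemma tofrac_inj (R : idomainType) : injective (@FracField.tofrac R).
Proof. by move=> x y /eqP; rewrite tofrac_eq => /eqP. Qed.

(** * The ring of integer-valued polynomials and its constants *)

Section IntegerValuedPolynomials.
Variable K : fieldType.
Local Notation KX := {fraction {poly K}}.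
Implicit Types (A B C D T : lset K) (L M N : lset KX) (a b c x : K) (z u : KX).

Lemma IntR_tofrac A (f : {poly K}) : IntR A f%:F <-> int_poly A f.
Proof. by split=> [[g [Ag /tofrac_inj->]]|Af]; [|exists f]. Qed.

Lemma IntR_emb A a : A a -> IntR A (emb a).
Proof. by move=> Aa; apply/IntR_tofrac => x _; rewrite hornerC. Qed.

Lemma IntR_emb_inv A a : is_subring A -> IntR A (emb a) -> A a.
Proof. by move=> [A0 _ _ _] /IntR_tofrac/(_ _ A0); rewrite hornerC. Qed.

Lemma IntR_subring A : is_subring A -> is_subring (IntR A).
Proof.
move=> [A0 A1 AB AM]; split.
- by rewrite -(rmorph0 (@emb K)); apply: IntR_emb.
- by rewrite -(rmorph1 (@emb K)); apply: IntR_emb.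
- move=> _ _ [f [Af ->]] [g [Ag ->]]; rewrite -rmorphB; apply/IntR_tofrac => x Ax.
  by rewrite hornerD hornerN; apply: AB; [apply: Af | apply: Ag].
- move=> _ _ [f [Af ->]] [g [Ag ->]]; rewrite -rmorphM; apply/IntR_tofrac => x Ax.
  by rewrite hornerM; apply: AM; [apply: Af | apply: Ag].
Qed.

Lemma embK_emb A a : A a -> embK A (emb a).
Proof. by exists a. Qed.

Lemma IntR_embK A z : embK A z -> IntR A z.
Proof. by move=> [a [Aa ->]]; apply: IntR_emb. Qed.

Lemma IntR_module_embK D A M : overring D A -> is_module (IntR A) M ->
  is_module (embK D) M.
Proof.
move=> [_ DA]; apply: is_module_sub => _ [a [Da ->]].
exact/IntR_emb/DA.
Qed.

Lemma overring_refl D : is_subring D -> overring D D.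
Proof. by []. Qed.

(** * Denominators in [D] and normal forms of invertible modules *)

Section Denominators.
Variable D : lset K.
Hypothesis Dqf : domain_with_qf D.

Let Dr : is_subring D := Dqf.1.
Let D1 : D 1. Proof. by case: Dr. Qed.
Let DM a b : D a -> D b -> D (a * b). Proof. by case: Dr => _ _ _; apply. Qed.

Lemma denominator x : exists q, [/\ D q, q != 0 & D (q * x)].
Proof.
have [a [b [Da Db /eqP b0 ->]]] := Dqf.2 x; exists b; split=> //.
by rewrite mulrCA divff ?mulr1.
Qed.

Lemma common_denominator (s : seq (K * K)) :
  exists q, [/\ D q, q != 0 & forall p, p \in s -> D (q * p.1)].
Proof.
elim: s => [|p s [q [Dq q0 qs]]]; first by exists 1; rewrite oner_neq0.
have [r [Dr' r0 rp]] := denominator p.1.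
exists (q * r); split; [exact: DM | exact: mulf_neq0 |].
move=> p'; rewrite inE => /orP[/eqP->|/qs Dqp]; first by rewrite -mulrA; apply: DM.
by rewrite mulrAC; apply: DM.
Qed.

(** One [q] serves all overrings and all arguments, since it only clears the coefficients of [f].
    The divisibility by [a - b] serves to compare the values of [f] at nearby points. *)
Lemma poly_denominator (f : {poly K}) : exists q, [/\ D q, q != 0 &
  forall T, overring D T -> forall a b, T a -> T b ->
  T (q * f.[a]) /\ exists w, T w /\ q * f.[a] - q * f.[b] = (a - b) * w].
Proof.
elim/poly_ind: f => [|f c [q [Dq q0 qf]]].
  exists 1; split; rewrite ?oner_neq0 // => T [[T0 _ _ _] _] a b _ _.
  by rewrite !horner0 mulr0; split=> //; exists 0; rewrite subrr mulr0.
have [r [Dr' r0 rc]] := denominator c.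
exists (q * r); split; [exact: DM | exact: mulf_neq0 |].
move=> T DT a b Ta Tb; have [[Tr sDT] [Tqa [w [Tw wE]]]] := (DT, qf T DT a b Ta Tb).
have [_ TD] := subring_add_closed Tr; have [_ _ _ TM] := Tr.
rewrite !hornerMXaddC; split.
  have -> : q * r * (f.[a] * a + c) = r * a * (q * f.[a]) + q * (r * c) by ring.
  by apply: TD; apply: (TM) => //; first apply: (TM) => //; apply: sDT.
exists (r * (q * f.[a] + b * w)); split.
  by apply: (TM); [apply: sDT | apply: TD => //; apply: TM].
have -> : (a - b) * (r * (q * f.[a] + b * w)) =
  r * ((a - b) * (q * f.[a]) + b * ((a - b) * w)) by ring.
by rewrite -wE; ring.
Qed.

Lemma IntR_denominator (f : {poly K}) : exists q, [/\ D q, q != 0 &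
  forall T, overring D T -> IntR T (emb q * f%:F)].
Proof.
have [q [Dq q0 qf]] := poly_denominator f; exists q; split=> // T DT.
rewrite -[emb q]/(q%:P%:F) -rmorphM; apply/IntR_tofrac => a Ta; rewrite hornerM hornerC.
by have [] := qf T DT a a Ta Ta.
Qed.

(** For a module [L] of polynomials over Int(A), with [A] an overring of [D], this amounts to [L
    K[X] = K[X]]. *)
Definition has_const L := exists c, [/\ D c, c != 0 & L (emb c)].

Definition normal_pair A L M :=
  [/\ is_module (IntR A) L, is_module (IntR A) M, prodset L M = IntR A,
      has_const L & has_const M].

Lemma normal_pairC A L M : normal_pair A L M -> normal_pair A M L.
Proof. by move=> [*]; split=> //; rewrite prodsetC. Qed.

(** A constant [d] of [M] multiplies [L] into Int(A), and dividing by [d] leaves a polynomial. *)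
Lemma normal_poly A L M z : normal_pair A L M -> L z -> exists f : {poly K}, z = f%:F.
Proof.
move=> [_ _ LM _ [d [_ d0 Md]]] Lz.
have : IntR A (z * emb d) by rewrite -LM; apply: prodset_mem.
move=> [f [_ fE]]; exists (d^-1%:P * f).
by rewrite tofracM -fE -[RHS]/(emb _ * _) fmorphV mulrCA mulVf ?mulr1 ?fmorph_eq0.
Qed.

Lemma normal_pair_IntR A : overring D A -> normal_pair A (IntR A) (IntR A).
Proof.
move=> [Ar DA]; have Rm := subring_module (IntR_subring Ar).
have c1 : has_const (IntR A).
  by exists 1; rewrite oner_neq0; split=> //; apply/IntR_emb/DA.
by split=> //; apply: prodset_module => //; have [] := IntR_subring Ar.
Qed.

(* [J K[X]] is generated by some [u], because [K[X]] is principal; dividing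
   [J] by [u] yields modules of polynomials which contain nonzero constants. *)
Lemma invertible_normal_form A J : overring D A -> invertible (IntR A) J ->
  exists u L M, [/\ u != 0, J = scale_set u L & normal_pair A L M].
Proof.
move=> DA [Jf [J' [J'f /set_eqE JJ']]].
have [Ar sDA] := DA; have Rr := IntR_subring Ar.
have [Jm J'm] := (frac_ideal_module Jf, frac_ideal_module J'f).
have [[J0 JD] JM] := Jm.
have [_ _ _ [z0 [Jz0 /eqP z00]] [e [Re /eqP e0 eJ]]] := Jf.
(* [P] is the ideal [e J K[X]] of [K[X]], written with denominators in [D]; a nonzero element [g] of
   least size will generate it. *)
pose P (p : {poly K}) := exists a z, [/\ D a, a != 0, J z & emb a * p%:F = e * z].
have PJ z : J z -> exists2 p, P p & e * z = p%:F.
  move=> Jz; have [p [_ pE]] := eJ z Jz; exists p => //.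
  by exists 1, z; rewrite oner_neq0 rmorph1 mul1r -pE.
have [|g [[Pg g0] gmin]] :=
    @exists_min _ (fun p => P p /\ p != 0) (fun p : {poly K} => size p).
  have [p Pp pE] := PJ z0 Jz0; exists p; split=> //.
  by rewrite -(tofrac_eq0 p) -pE; exact: mulf_neq0 e0 z00.
have Pdvd p : P p -> exists h, p = h * g.
  move=> [a [z [Da a0 Jz pE]]]; exists (p %/ g).
  have [b [y [Db b0 Jy gE]]] := Pg.
  suff /eqP modp0 : p %% g == 0 by rewrite {1}(divp_eq p g) modp0 addr0.
  (* Once the denominators of the quotient are cleared, a nonzero remainder would be a smaller
     element of [P]. *)
  apply/negP => /negP modp0; have [q [Dq q0 Rq]] := IntR_denominator (- (p %/ g)).
  have := ltn_modp p g; rewrite g0 ltnNge gmin //; split=> //.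
  exists (a * b * q), (emb (b * q) * z + emb a * (emb q * (- (p %/ g))%:F * y)).
  split; [by do !apply: DM | by rewrite !mulf_neq0 | |].
    apply: JD; apply: (JM) => //; [|exact/IntR_emb/sDA|by apply: JM => //; apply: Rq].
    by apply/IntR_emb/sDA/DM.
  have -> : (p %% g)%:F = p%:F + (- (p %/ g))%:F * g%:F.
    by rewrite -rmorphM -rmorphD mulNr {2}(divp_eq p g) addrAC subrr add0r.
  rewrite !rmorphM; move: pE gE; set E := (- _)%:F; move=> pE gE.
  transitivity (emb b * emb q * (emb a * p%:F) + emb a * emb q * E * (emb b * g%:F)).
    by ring.
  by rewrite pE gE; ring.
(* Dividing by [e] undoes the multiplication built into [P], so [u] generates [J K[X]]. *)
pose u := g%:F / e.
have u0 : u != 0 by rewrite mulf_neq0 ?invr_eq0 ?tofrac_eq0.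
have LM : prodset (scale_set u^-1 J) (scale_set u J') = IntR A.
  rewrite scale_set_prod [prodset J _]prodsetC scale_set_prod prodsetC JJ'.
  by rewrite scale_scale_set mulVf ?scale1_set.
exists u, (scale_set u^-1 J), (scale_set u J'); split=> //; first by rewrite scale_setK.
have Mm := scale_set_module u J'm; have [[M0 MD] MM] := Mm.
split=> //; first exact: scale_set_module.
  have [a [z [Da a0 Jz gE]]] := Pg; exists a; split=> //; exists z; split=> //.
  apply: (mulfI u0); rewrite mulrA (divff u0) mul1r; apply: (mulfI e0).
  by rewrite -gE mulrA [e * u]mulrC divfK // mulrC.
(* For [z] in [J], [u^-1 * z] is a polynomial, so some constant of [D] multiplies it into Int(A).
   Hence [Q] holds on the whole product, which contains 1. *)
pose Q (x : KX) := exists d, [/\ D d, d != 0 & scale_set u J' (emb d * x)].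
suff [d [Dd d0]] : Q 1 by rewrite mulr1; exists d.
apply: (@prodset_ind _ (scale_set u^-1 J) (scale_set u J')).
- split; first by exists 1; rewrite mulr0 oner_neq0.
  move=> x y [a [Da a0 ax]] [b [Db b0 bY]]; exists (a * b).
  split; [exact: DM | exact: mulf_neq0 |].
  rewrite rmorphM.
  have -> : emb a * emb b * (x + y) = emb b * (emb a * x) + emb a * (emb b * y) by ring.
  by apply: MD; apply: MM => //; apply/IntR_emb/sDA.
- move=> _ y [z [Jz ->]] My; have [p Pp pE] := PJ z Jz; have [h hE] := Pdvd p Pp.
  have -> : u^-1 * z = h%:F.
    by rewrite /u invf_div mulrAC pE hE rmorphM mulfK ?tofrac_eq0.
  have [q [Dq q0 Rq]] := IntR_denominator h; exists q; split=> //.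
  by rewrite mulrA; apply: MM => //; apply: Rq.
- by rewrite LM; have [] := Rr.
Qed.

End Denominators.

(* For an ideal [B] this says [B T = T]. *)
Definition covers T B := prodset B T 1.

(** Multiplying two expressions of 1 gives a third; conditions on multipliers can thus be imposed
    one after another. *)
Lemma covers_mul T A B C : is_subring T -> covers T A -> covers T B ->
  (forall a b, A a -> B b -> C (a * b)) -> covers T C.
Proof.
move=> [_ _ _ TM] TA TB ABC.
apply: (prodset_ind (prodset_add_closed C T)) TA => a t Aa Tt.
rewrite -[a * t]mulr1; move: TB; apply: prodset_mul_closed.
  exact: prodset_add_closed.
move=> b s Bb Ts; have -> : a * t * (b * s) = a * b * (t * s) by ring.
by apply: prodset_mem; [apply: ABC | apply: TM].
Qed.

Lemma covers_sub T A B : (forall a, A a -> B a) -> covers T A -> covers T B.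
Proof.
move=> AB; apply: prodset_ind; first exact: prodset_add_closed.
by move=> a t /AB Ba Tt; apply: prodset_mem.
Qed.

Lemma covers1 T B : T 1 -> B 1 -> covers T B.
Proof. by move=> T1 B1; rewrite /covers -[X in prodset _ _ X]mul1r; apply: prodset_mem. Qed.

(** Flat extension commutes with the intersection of [D] and [B]. Clearing denominators in an
    expression of 1 gives a [D]-linear relation, and trivializing it rewrites 1 with coefficients in
    both. *)
Lemma flat_cap D T B : domain_with_qf D -> overring D T -> flat_over D T ->
  is_module D B -> covers T B -> covers T (fun b => D b /\ B b).
Proof.
move=> Dqf [Tr DT] Tf [Bc BM] [s [Bs sE]].
have DN := @subring_opp _ D ^~ Dqf.1.
have [q [Dq q0 Dqs]] := common_denominator Dqf s.
pose p (i : 'I_(size s)) := nth (0, 0) s i.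
have ps i : p i \in s by apply: mem_nth.
(* Index 0 pairs [-q] with 1, the other indices carry the expression of 1 scaled by [q], and the
   total vanishes. *)
pose a (i : 'I_(size s).+1) := if unlift ord0 i is Some j then q * (p j).1 else - q.
pose m (i : 'I_(size s).+1) := if unlift ord0 i is Some j then (p j).2 else 1.
have [||| k [b [y [Db Ty mE aE]]]] := Tf _ a m.
- by move=> i; rewrite /a; case: unliftP => [j _|_]; [apply: Dqs | apply: DN].
- move=> i; rewrite /m; case: unliftP => [j _|_]; last by case: Tr.
  by have [] := Bs _ (ps j).
- rewrite big_ord_recl /a /m unlift_none mulr1.
  rewrite (eq_bigr (fun i => q * ((p i).1 * (p i).2))); last first.
    by move=> i _; rewrite liftK mulrA.
  rewrite -mulr_sumr; suff -> : \sum_i (p i).1 * (p i).2 = 1 by rewrite mulr1 addNr.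
  by rewrite sE (big_nth (0, 0)) big_mkord.
rewrite /covers; have -> : 1 = \sum_j b ord0 j * y j by rewrite -mE /m unlift_none.
apply: add_closed_sum => [|j _]; first exact: prodset_add_closed.
apply: prodset_mem => //; split=> //.
(* Column [j] of the trivialization, divided by [q], expresses [b ord0 j] through elements of
   [B]. *)
suff -> : b ord0 j = \sum_i b (lift ord0 i) j * (p i).1.
  apply: add_closed_sum => // i _; apply: BM => //.
  by have [] := Bs _ (ps i).
apply: (mulfI q0); apply/eqP; rewrite eq_sym -subr_eq0 addrC -mulNr mulr_sumr.
apply/eqP; rewrite -[RHS](aE j) big_ord_recl /a unlift_none; congr (_ + _).
by apply: eq_bigr => i _; rewrite liftK mulrA mulrAC.
Qed.


(** * Localization of modules at an overring *)

Section Localization.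
Variables D T : lset K.
Hypothesis Dr : is_subring D.
Hypothesis DT : overring D T.

Let DM a b : D a -> D b -> D (a * b). Proof. by case: Dr => _ _ _; apply. Qed.

(* [loc M] is the extension [M T] when [T] is flat over [D]. *)
Definition loc M z := covers T (fun b => D b /\ M (emb b * z)).

Lemma loc_self M z : M z -> loc M z.
Proof.
move=> Mz; apply: covers1; first by case: DT.1.
by rewrite rmorph1 mul1r; split=> //; case: Dr.
Qed.

Lemma loc_sub M N z : (forall z, M z -> N z) -> loc M z -> loc N z.
Proof. by move=> MN; apply: covers_sub => b [Db /MN]. Qed.

Lemma loc_add_closed M : is_module (embK D) M -> add_closed (loc M).
Proof.
move=> [[M0 MD] MM]; split; first exact: loc_self.
move=> y z My Mz; apply: covers_mul DT.1 My Mz _ => a b [Da May] [Db Mbz].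
split; first exact: DM.
rewrite rmorphM.
have -> : emb a * emb b * (y + z) = emb b * (emb a * y) + emb a * (emb b * z) by ring.
by apply: MD; apply: MM => //; apply: embK_emb.
Qed.

Lemma loc_mul M N y z : loc M y -> loc N z -> loc (prodset M N) (y * z).
Proof.
move=> My Nz; apply: covers_mul DT.1 My Nz _ => a b [Da May] [Db Nbz].
by split; [exact: DM | rewrite rmorphM mulrACA; apply: prodset_mem].
Qed.

(** Expanding 1 as a sum of products [b * t], with [b z] in [M], writes [z] as the sum of the
    [t (b z)]. *)
Lemma loc_elim M N z : is_module (embK T) N -> (forall z, M z -> N z) ->
  loc M z -> N z.
Proof.
move=> [[N0 ND] NM] MN Mz.
suff: N (emb 1 * z) by rewrite rmorph1 mul1r.
apply: (@prodset_ind _ _ _ (fun x => N (emb x * z))) Mz.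
  split; first by rewrite rmorph0 mul0r.
  by move=> x y Nx Ny; rewrite rmorphD mulrDl; apply: ND.
move=> b t [_ /MN Nbz] Tt; rewrite [b * t]mulrC rmorphM -mulrA.
by apply: NM => //; apply: embK_emb.
Qed.

End Localization.

End IntegerValuedPolynomials.

Lemma polyC_factor (K : fieldType) (c : K) (p q : {poly K}) : c != 0 ->
  c%:P = p * q -> exists k, p = k%:P.
Proof.
move=> c0 cE; have /eqP := congr1 (fun r : {poly K} => size r) cE.
have p0 : p != 0 by apply: contraNneq c0 => p0; rewrite -polyC_eq0 cE p0 mul0r.
have q0 : q != 0 by apply: contraNneq c0 => q0; rewrite -polyC_eq0 cE q0 mulr0.
rewrite size_polyC c0 eq_sym size_mul_eq1 // => /andP[/size_poly1P[k _ ->] _].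
by exists k.
Qed.

(** * Modules extended from ideals of constants *)

Section ExtendedIdeals.
Variable K : fieldType.
Local Notation KX := {fraction {poly K}}.
Implicit Types (A B I T : lset K).

Lemma iota_int_module A I : is_subring A -> is_module (IntR A) (iota_int A I).
Proof. by move=> Ar; apply/is_module_prod/subring_module/IntR_subring. Qed.

Lemma iota_int_emb A I (a : K) : is_subring A -> I a -> iota_int A I (emb a).
Proof.
move=> Ar Ia; rewrite -[emb a]mulr1; apply: prodset_mem; first exact: embK_emb.
by have [] := IntR_subring Ar.
Qed.

Lemma iota_int_tofrac A I z : iota_int A I z -> exists f : {poly K}, z = f%:F.
Proof.
apply: (@prodset_ind _ _ _ (fun z => exists f : {poly K}, z = f%:F)).
  split; first by exists 0; rewrite rmorph0.
  by move=> _ _ [f ->] [g ->]; exists (f + g); rewrite tofracD.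
by move=> _ _ [a [_ ->]] [f [_ ->]]; exists (a%:P * f); rewrite tofracM.
Qed.

(** Evaluation at 0 fixes the constants and maps [iota_int A I] into [I]. *)
Lemma iota_int_emb_inv A I (a : K) : is_subring A -> is_module A I ->
  iota_int A I (emb a) -> I a.
Proof.
move=> [A0 A1 AB AM] [[I0 ID] IM].
suff sub z : iota_int A I z -> exists f : {poly K}, z = f%:F /\ I f.[0].
  by move=> /sub[f [/tofrac_inj <-]]; rewrite hornerC.
apply: (@prodset_ind _ _ _ (fun z => exists f : {poly K}, z = f%:F /\ I f.[0])).
  split; first by exists 0; rewrite rmorph0 horner0.
  move=> _ _ [f [-> If]] [g [-> Ig]]; exists (f + g).
  by rewrite tofracD hornerD; split=> //; apply: ID.
move=> _ _ [b [Ib ->]] [f [Af ->]]; exists (b%:P * f).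
by rewrite tofracM hornerM hornerC; split=> //; rewrite mulrC; apply: IM => //; apply: Af.
Qed.

Lemma iota_int_self A : is_subring A -> iota_int A A = IntR A.
Proof.
move=> Ar; rewrite /iota_int prodsetC; apply: prodset_module; last first.
  by exists 1; rewrite rmorph1; split=> //; case: Ar.
have := subring_module (IntR_subring Ar).
by apply: is_module_sub => z; apply: IntR_embK.
Qed.

Lemma embK_prod I J : embK (prodset I J) = prodset (embK I) (embK J).
Proof.
apply: lsetP => z; split.
  move=> [a [IJa ->]]; rewrite -/(emb a); move: a IJa.
  apply: prodset_ind.
    have [P0 PD] := prodset_add_closed (embK I) (embK J).
    by split; [rewrite rmorph0 | move=> x y Px Py; rewrite rmorphD; apply: PD].
  by move=> a b Ia Jb; rewrite rmorphM; apply: prodset_mem; apply: embK_emb.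
apply: prodset_ind.
  have [P0 PD] := prodset_add_closed I J; split; first by exists 0; rewrite rmorph0.
  move=> _ _ [a [Pa ->]] [b [Pb ->]]; exists (a + b); rewrite -[RHS]/(emb _) rmorphD.
  by split=> //; apply: PD.
move=> _ _ [a [Ia ->]] [b [Jb ->]]; exists (a * b); rewrite -[RHS]/(emb _) rmorphM.
by split=> //; apply: prodset_mem.
Qed.

Lemma iota_int_prod A I J : is_subring A ->
  prodset (iota_int A I) (iota_int A J) = iota_int A (prodset I J).
Proof.
move=> Ar; have Rr := IntR_subring Ar; rewrite /iota_int embK_prod.
have RR : prodset (IntR A) (IntR A) = IntR A.
  by apply: prodset_module; [apply: subring_module | case: Rr].
rewrite -{3}RR -!prodsetA; congr prodset.
by rewrite [RHS]prodsetC -prodsetA [prodset (IntR A) (embK J)]prodsetC.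
Qed.

(** The generator [u] is a polynomial dividing the nonzero constant [a], so it is itself constant;
    comparing constants on both sides shows that it generates [I]. *)
Lemma pic_eq_iota_int A I : is_subring A -> is_module A I ->
  (exists2 a, I a & a != 0) -> pic_eq (iota_int A I) (IntR A) -> pic_eq I A.
Proof.
move=> Ar Im [a Ia a0] /pic_eqP[u [u0 Iu]].
have [_ R1 _ _] := IntR_subring Ar.
have [p pE] : exists p : {poly K}, u = p%:F.
  apply: (@iota_int_tofrac A I); rewrite Iu; exists 1; rewrite mulr1; split=> //.
have [c cE] : exists c, u = emb c.
  have := iota_int_emb Ar Ia; rewrite Iu => -[_ [[f [_ ->]]]].
  rewrite pE -tofracM => /tofrac_inj/(polyC_factor a0)[c ->].
  by exists c.
rewrite {}cE in u0 Iu; apply/pic_eqP; exists c; split; first by rewrite -(fmorph_eq0 (@emb K)).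
apply: lsetP => x; split.
  move=> Ix; have := iota_int_emb Ar Ix; rewrite Iu => -[y [Ry xy]].
  have yE : y = emb (c^-1 * x) by rewrite rmorphM fmorphV /= xy mulKf.
  rewrite yE in Ry; exists (c^-1 * x); split; first exact: IntR_emb_inv Ry.
  by rewrite mulVKf // -(fmorph_eq0 (@emb K)).
move=> [y [Ay ->]]; apply: (iota_int_emb_inv Ar Im); rewrite Iu rmorphM.
by exists (emb y); split=> //; apply: IntR_emb.
Qed.

End ExtendedIdeals.

(** * Local-global principles, density and approximation for Jaffard families *)

Section Jaffard.
Variables (K : fieldType) (D : lset K) (Theta : lset K -> Prop).
Hypothesis Dqf : domain_with_qf D.
Hypothesis Theta_jaffard : jaffard D Theta.
Local Notation KX := {fraction {poly K}}.
Implicit Types (T B I : lset K) (J L M : lset KX).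

Let Dr : is_subring D := Dqf.1.
Let D0 : D 0. Proof. by case: Dr. Qed.
Let D1 : D 1. Proof. by case: Dr. Qed.
Let DM a b : D a -> D b -> D (a * b). Proof. by case: Dr => _ _ _; apply. Qed.
Let DD a b : D a -> D b -> D (a + b). Proof. exact: (subring_add_closed Dr).2. Qed.

Lemma jaffard_overring T : Theta T -> overring D T.
Proof. by case: Theta_jaffard => -[_ Tf _ _ _] _ /Tf[]. Qed.

Lemma jaffard_flat T : Theta T -> flat_over D T.
Proof. by case: Theta_jaffard => -[_ Tf _ _ _] _ /Tf[]. Qed.

(** Applied to ideals of multipliers: a property reached after multiplication by elements covering
    every member holds without multiplication. *)
Lemma jaffard_complete B : ideal_of D B -> (forall T, Theta T -> covers T B) -> B 1.
Proof. by case: Theta_jaffard => -[_ _ Tc _ _] _ Bi TB; apply/(Tc _ Bi). Qed.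

(** Over an empty family, completeness would put 1 in the zero ideal. *)
Lemma jaffard_nonempty : exists T, Theta T.
Proof.
apply: contrapT => T0; have /eqP := oner_neq0 K; apply.
apply: (@jaffard_complete (fun x => x = 0)); last by move=> T TT; case: T0; exists T.
split=> // [_ -> //|x y -> ->|r x _ ->]; [by rewrite addr0 | by rewrite mulr0].
Qed.

Lemma jaffard_bigcap x : (forall T, Theta T -> T x) -> D x.
Proof.
case: Theta_jaffard => -[_ _ Tc _ _] _ Tx.
have DI : ideal_of D D by [].
apply/(Tc _ DI) => T TT; rewrite -[x]mul1r; apply: prodset_mem => //.
exact: Tx.
Qed.

(** For nonzero [t], [flat_cap] applies to [t^-1 D], whose product with [T] contains [t^-1 * t]. *)
Lemma covers_denominators T t : Theta T -> T t -> covers T (fun b => D b /\ D (b * t)).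
Proof.
move=> TT Tt; have TD := jaffard_overring TT; have [Tr _] := TD.
have [t0|t0] := eqVneq t 0.
  by apply: covers1; [case: Tr | rewrite t0 mulr0; split].
apply: (flat_cap Dqf TD (jaffard_flat TT)).
  split; last by move=> a x Da Dxt; rewrite -mulrA; apply: DM.
  by split=> [|x y Dx Dy]; rewrite ?mul0r // mulrDl; apply: DD.
rewrite /covers -[X in prodset _ _ X](mulVf t0); apply: prodset_mem => //.
by rewrite mulVf.
Qed.

(** By independence [x^-1] lies in [T T'], so [x T T'] contains 1; flatness of [T'] then allows
    intersecting [x T] with [D]. *)
Lemma covers_independent T T' x : Theta T -> Theta T' -> T <> T' -> x != 0 ->
  covers T' (fun b => D b /\ scale_set x T b).
Proof.
move=> TT TT' neqT x0; have [Tr DT] := jaffard_overring TT.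
apply: (flat_cap Dqf (jaffard_overring TT') (jaffard_flat TT')).
  apply: is_module_sub DT _; exact/scale_set_module/subring_module.
have : prodset T T' x^-1.
  by case: Theta_jaffard => -[_ _ _ /(_ _ _ TT TT' neqT) -> _] _.
rewrite /covers scale_set_prod => Tx.
by exists x^-1; rewrite divff.
Qed.

(** The multipliers in [D] bringing [z] into [M] form an ideal covering every member. *)
Lemma jaffard_descent M z : is_module (embK D) M ->
  (forall T, Theta T -> loc D T M z) -> M z.
Proof.
move=> [[M0 MD] MM] Mz.
suff [_ ] : D 1 /\ M (emb 1 * z) by rewrite rmorph1 mul1r.
apply: (@jaffard_complete (fun b => D b /\ M (emb b * z))) => //; split.
- by move=> x [].
- by rewrite rmorph0 mul0r.
- move=> x y [Dx Mx] [Dy My]; rewrite rmorphD mulrDl.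
  by split; [apply: DD | apply: MD].
- move=> r x Dr' [Dx Mx]; rewrite rmorphM -mulrA.
  by split; [apply: DM | apply: MM => //; apply: embK_emb].
Qed.

(** The [b] with [b t] in [D + y T] form an ideal. At [T] it contains the denominators of [t]; at
    another member independence supplies multiples [b] of [y / t] in [y / t T], for which [b t] is
    in [y T]. *)
Lemma jaffard_dense T t y : Theta T -> T t -> y != 0 ->
  exists a w, [/\ D a, T w & t = a + y * w].
Proof.
move=> TT Tt y0; have [Tr DT] := jaffard_overring TT.
have [T0 T1 _ TM] := Tr; have [_ TD] := subring_add_closed Tr.
have [->|t0] := eqVneq t 0; first by exists 0, 0; rewrite mulr0 addr0.
pose B b := D b /\ exists a w, [/\ D a, T w & b * t = a + y * w].
suff [_ [a [w [Da Tw]]]] : B 1 by rewrite mul1r; exists a, w.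
apply: jaffard_complete => [|T' TT'].
  split.
  - by move=> x [].
  - by split=> //; exists 0, 0; rewrite mul0r mulr0 addr0.
  - move=> b b' [Db [a [w [Da Tw E]]]] [Db' [a' [w' [Da' Tw' E']]]].
    split; first exact: DD.
    exists (a + a'), (w + w'); rewrite mulrDl E E'; split; [exact: DD|exact: TD|ring].
  - move=> r b Dr' [Db [a [w [Da Tw E]]]]; split; first exact: DM.
    exists (r * a), (r * w); rewrite -mulrA E.
    by split; [exact: DM|apply: TM => //; apply: DT|ring].
have [eqT|neqT] := EM (T = T').
  rewrite -eqT; apply: covers_sub (covers_denominators TT Tt) => b [Db Dbt].
  by split=> //; exists (b * t), 0; rewrite mulr0 addr0.
have x0 : y / t != 0 by rewrite mulf_neq0 ?invr_eq0.
apply: covers_sub (covers_independent TT TT' neqT x0) => b [Db [w [Tw bE]]].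
split=> //; exists 0, w; split=> //; rewrite bE.
by rewrite add0r mulrAC divfK.
Qed.

(** By density [t] is congruent to some [a] of [D] modulo [q T], where [q] clears the coefficients
    of [f]. Then [q f.[t]] and [q f.[a]] differ by an element of [q T], and [q] cancels. *)
Lemma IntR_jaffard_sub T z : Theta T -> IntR D z -> IntR T z.
Proof.
move=> TT [f [Df ->]]; apply/IntR_tofrac => t Tt.
have TD := jaffard_overring TT; have [Tr DT] := TD.
have [q [Dq q0 /(_ T TD)qf]] := poly_denominator Dqf f.
have [a [w [Da Tw tE]]] := jaffard_dense TT Tt q0.
have [_ [v [Tv vE]]] := qf t a Tt (DT a Da).
have -> : f.[t] = f.[a] + w * v.
  apply: (mulfI q0); rewrite -[LHS](subrK (q * f.[a])) vE tE.
  by ring.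
have [_ TA] := subring_add_closed Tr; have [_ _ _ TM] := Tr.
by apply: TA; [apply/DT/Df | apply: TM].
Qed.

Lemma IntR_jaffard_bigcap z : (forall T, Theta T -> IntR T z) -> IntR D z.
Proof.
(* One member is needed to know that [z] is a polynomial. *)
move=> Tz; have [T TT] := jaffard_nonempty; have [f [_ zE]] := Tz T TT.
exists f; split=> // a Da; apply: jaffard_bigcap => T' TT'.
have := Tz T' TT'; rewrite zE => /IntR_tofrac; apply.
exact: (jaffard_overring TT').2.
Qed.

(* Approximation: away from finitely many members, [e] is a unit; at these
   members [b] is made divisible by [e]. *)
Lemma covers_multiples T (e : K) (s : list (lset K)) : Theta T -> e != 0 ->
  covers T (fun b => D b /\ forall T', List.In T' s -> Theta T' -> T' <> T ->
                       scale_set e T' b).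
Proof.
move=> TT e0; have [Tr DT] := jaffard_overring TT.
elim: s => [|T0 s IHs]; first by apply: covers1; [case: Tr | split].
(* A list entry outside [Theta], or equal to [T], imposes no condition. *)
have [[TT0 neqT]|nT0] := EM (Theta T0 /\ T0 <> T); last first.
  apply: covers_sub IHs => b [Db sb]; split=> // T' [<-|]; last exact: sb.
  by move=> TT0 neqT; case: nT0.
have T0c := covers_independent TT0 TT neqT e0.
apply: covers_mul Tr IHs T0c _ => a b [Da sa] [Db [w [T0w bE]]].
split=> [|T' T's TT' neqT']; first exact: DM.
have [T'r DT'] := jaffard_overring TT'; have [_ _ _ T'M] := T'r.
case: T's => [eqT'|T's].
  rewrite -{}eqT' in DT' T'M *; exists (a * w); rewrite bE mulrCA; split=> //.
  by apply: T'M => //; apply: DT'.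
have [v [T'v aE]] := sa T' T's TT' neqT'; exists (v * b); rewrite aE mulrA.
by split=> //; apply: T'M => //; apply: DT'.
Qed.

Lemma jaffard_nonunits (e : K) : D e -> e != 0 ->
  exists s : list (lset K), forall T, Theta T -> ~ unit_in T e -> List.In T s.
Proof. by move=> De /eqP e0; case: Theta_jaffard => _; apply. Qed.

(** * Gluing local modules that are trivial at almost all members *)

Section Glue.
Variables (F : lset K -> lset KX) (s : list (lset K)).
Hypothesis F_module : forall T, Theta T -> is_module (IntR T) (F T).
Hypothesis F_const : forall T, Theta T -> has_const D (F T).
Hypothesis F_poly : forall T z, Theta T -> F T z -> exists f : {poly K}, z = f%:F.
Hypothesis F_out : forall T, Theta T -> ~ List.In T s -> F T = IntR T.

Definition glue : lset KX := fun z => forall T, Theta T -> F T z.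

Lemma glue_module : is_module (IntR D) glue.
Proof.
split; first split.
- by move=> T /F_module[[]].
- by move=> x y Fx Fy T TT; have [[_ FD] _] := F_module TT; apply: FD; auto.
- move=> a x Da Fx T TT; have [_ FM] := F_module TT.
  by apply: FM; [exact: IntR_jaffard_sub Da | exact: Fx].
Qed.

(** Off [s] every constant of [D] qualifies, so a product of constants over the finite list
    suffices. *)
Lemma common_const : exists c, [/\ D c, c != 0 & forall T, Theta T -> F T (emb c)].
Proof.
suff [c [Dc c0 Fc]] : exists c, [/\ D c, c != 0 &
    forall T, List.In T s -> Theta T -> F T (emb c)].
  exists c; split=> // T TT; have [/Fc/(_ TT)//|nTs] := EM (List.In T s).
  by rewrite F_out //; apply/IntR_emb/(jaffard_overring TT).2.
elim: (s) => [|T0 s' [c [Dc c0 Fc]]]; first by exists 1; rewrite oner_neq0.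
have [[d [Dd d0 Fd]]|nd] := EM (exists d, [/\ D d, d != 0 & Theta T0 -> F T0 (emb d)]);
    last first.
  have [/F_const[d [Dd d0 Fd]]|nT0] := EM (Theta T0); case: nd; first by exists d.
  by exists 1; rewrite oner_neq0.
exists (c * d); split; [exact: DM | exact: mulf_neq0 |].
move=> T Ts TT; have [_ FM] := F_module TT; have [_ DT] := jaffard_overring TT.
rewrite rmorphM; case: Ts => [eqT|Ts].
  by apply: FM; [apply/IntR_emb/DT | rewrite -eqT in TT *; exact: Fd].
by rewrite mulrC; apply: FM; [apply/IntR_emb/DT | apply: Fc].
Qed.

(** The constant [e = q * c] brings [z] into every [F T']. At the finitely many other members where
    [e] is not a unit, the multiplier [b] is taken divisible by [e]; where [e] is a unit it is
    inverted. *)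
Lemma loc_glue T z : Theta T -> loc D T glue z <-> F T z.
Proof.
move=> TT; have TD := jaffard_overring TT; split.
  apply: loc_elim => [|y]; last exact.
  exact: IntR_module_embK (overring_refl TD.1) (F_module TT).
move=> Fz; have [f zE] := F_poly TT Fz.
have [c [Dc c0 Fc]] := common_const.
have [q [Dq q0 Rq]] := IntR_denominator Dqf f.
have Fe T' : Theta T' -> F T' (emb (q * c) * z).
  move=> TT'; rewrite rmorphM mulrAC zE; have [_ FM] := F_module TT'.
  by apply: FM; [apply/Rq/jaffard_overring | apply: Fc].
have e0 : q * c != 0 by exact: mulf_neq0.
have [s' s'P] := jaffard_nonunits (DM Dq Dc) e0.
apply: covers_sub (covers_multiples s' TT e0) => b [Db s'b]; split=> // T' TT'.
have [_ FM] := F_module TT'; have [_ DT'] := jaffard_overring TT'.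
have [->|neqT] := EM (T' = T).
  by have [_ FTM] := F_module TT; apply: FTM => //; apply/IntR_emb/TD.2.
have [[y [T'y ey]]|nu] := EM (unit_in T' (q * c)).
  apply: (FM); first exact/IntR_emb/DT'.
  rewrite -[z]mul1r -(rmorph1 (@emb K)) -ey mulrC rmorphM mulrA mulrC.
  by apply: FM; [apply: IntR_emb | rewrite mulrC; exact: Fe].
have [w [T'w ->]] := s'b T' (s'P T' TT' nu) TT' neqT.
rewrite [_ * w]mulrC rmorphM -mulrA; apply: FM; [exact: IntR_emb | exact: Fe].
Qed.

End Glue.

(** Gluing the family of all Int(T), with no exceptional member, gives a module inside Int(D). *)
Lemma loc_IntR T z : Theta T -> IntR T z -> loc D T (IntR D) z.
Proof.
move=> TT Tz; apply: (@loc_sub _ D T (glue (@IntR K))) => [y|].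
  exact: IntR_jaffard_bigcap.
apply/(@loc_glue (@IntR K) [::]) => // {TT Tz}T.
- by move=> /jaffard_overring[/IntR_subring/subring_module].
- move=> /jaffard_overring[_ DT]; exists 1; rewrite oner_neq0; split=> //.
  exact/IntR_emb/DT.
- by move=> y _ [f [_ ->]]; exists f.
Qed.

(** Multipliers covering [T] bring each element of Int(T) into Int(D), so extending scalars to
    Int(T) only adds denominators from [D]. *)
Lemma prodset_IntR T M : Theta T -> is_module (IntR D) M ->
  prodset M (IntR T) = loc D T M.
Proof.
move=> TT Mm; have TD := jaffard_overring TT.
have MD := IntR_module_embK (overring_refl Dr) Mm.
have Tm := subring_module (IntR_subring TD.1); have [_ T1 _ _] := IntR_subring TD.1.
apply: lsetP => z; split.
  apply: prodset_ind; first exact: loc_add_closed.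
  move=> m f Mm' Tf; have := loc_mul Dr TD (loc_self Dr TD Mm') (loc_IntR TT Tf).
  rewrite prodset_module //; last by have [] := IntR_subring Dr.
apply: loc_elim.
  exact: IntR_module_embK (overring_refl TD.1) (is_module_prod M Tm).
by move=> y My; rewrite -[y]mulr1; apply: prodset_mem.
Qed.

End Jaffard.

(** * Finite support, kernel and image of the extension map *)

Section PicardSequence.
Variables (K : fieldType) (D : lset K) (Theta : lset K -> Prop).
Hypothesis Dqf : domain_with_qf D.
Hypothesis Theta_jaffard : jaffard D Theta.
Local Notation KX := {fraction {poly K}}.
Implicit Types (A T B I : lset K) (J L M : lset KX).

Let Dr : is_subring D := Dqf.1.
Let DD : overring D D := overring_refl Dr.
Let over T : Theta T -> overring D T := @jaffard_overring _ _ _ Theta_jaffard T.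
Let subI T z : Theta T -> IntR D z -> IntR T z :=
  @IntR_jaffard_sub _ _ _ Dqf Theta_jaffard T z.

(** The constant of [L] is a nonzero element, and that of [M] a common denominator. *)
Lemma normal_pair_invertible A L M : overring D A -> normal_pair D A L M ->
  invertible (IntR A) L.
Proof.
move=> [_ DA].
have frac L' M' : normal_pair D A L' M' -> frac_ideal (IntR A) L'.
  move=> [[[L0 LD] LM] _ LM' [c [Dc c0 Lc]] [d [Dd d0 Md]]]; split=> //.
    by exists (emb c); split=> //; apply/eqP; rewrite fmorph_eq0.
  exists (emb d); split; first exact/IntR_emb/DA.
    by apply/eqP; rewrite fmorph_eq0.
  by move=> x Lx; rewrite -LM' mulrC; apply: prodset_mem.
move=> LM; split; first exact: frac LM.
by exists M; split; [apply/frac/normal_pairC/LM | case: LM => _ _ ->].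
Qed.

Lemma in_im_iota_scale T u : is_subring T -> u != 0 ->
  in_im_iota T (scale_set u (IntR T)).
Proof.
move=> Tr u0; exists T; split; first exact: invertible_self.
by apply/pic_eqP; exists u; rewrite iota_int_self.
Qed.

Lemma extension_finite_support J : invertible (IntR D) J ->
  exists s : list (lset K), forall T, Theta T ->
    ~ in_im_iota T (prodset J (IntR T)) -> List.In T s.
Proof.
move=> /(invertible_normal_form Dqf DD)[u [L [M [u0 JE LM]]]].
have [_ _ LME [c [Dc c0 Lc]] [d [Dd d0 Md]]] := LM.
have [sc scP] := jaffard_nonunits Theta_jaffard Dc c0.
have [sd sdP] := jaffard_nonunits Theta_jaffard Dd d0.
exists (sc ++ sd)%list => T TT; apply: contra_notP => nTs.
have [Tr DT] := over TT; have Rr := IntR_subring Tr; have [Rc Rm] := subring_module Rr.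
have [x [Tx cx]] : unit_in T c.
  by apply: contrapT => /(scP T TT) Ts; apply/nTs/List.in_or_app; left.
have [y [Ty dy]] : unit_in T d.
  by apply: contrapT => /(sdP T TT) Ts; apply/nTs/List.in_or_app; right.
(* As [d L] lies in Int(D), the unit [d] gives one inclusion; the unit [c] in [L] gives the
   other. *)
suff LT : prodset L (IntR T) = IntR T.
  by rewrite JE scale_set_prod LT; apply: in_im_iota_scale.
apply: lsetP => z; split.
  apply: prodset_ind => // l f Ll Tf.
  have -> : l * f = emb y * (l * emb d) * f.
    by rewrite mulrCA -rmorphM [y * d]mulrC dy rmorph1 mulr1.
  apply: (Rm) => //; apply: (Rm); first exact: IntR_emb.
  by apply: subI => //; rewrite -LME; apply: prodset_mem.
move=> Tz; have -> : z = emb c * (emb x * z).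
  by rewrite mulrA -rmorphM cx rmorph1 mul1r.
by apply: prodset_mem => //; apply: Rm => //; apply: IntR_emb.
Qed.

Lemma prodset_iota_int T I : Theta T ->
  prodset (iota_int D I) (IntR T) = iota_int T (prodset I T).
Proof.
move=> TT; have [Tr _] := over TT; have Rm := subring_module (IntR_subring Tr).
rewrite /iota_int embK_prod -!prodsetA; congr prodset.
rewrite -/(iota_int T T) iota_int_self // prodsetC prodset_module //.
  by apply: is_module_sub Rm => z; apply: subI.
by have [] := IntR_subring Dr.
Qed.

Lemma in_im_iota_extend T J : Theta T -> in_im_iota D J ->
  in_im_iota T (prodset J (IntR T)).
Proof.
move=> TT [I [Ii /pic_eqP[u [u0 ->]]]]; have [Tr DT] := over TT.
exists (prodset I T); split; first exact: invertible_extend DT Ii.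
by apply/pic_eqP; exists u; rewrite scale_set_prod prodset_iota_int.
Qed.

(** The inverse of [I] is the conductor of [I] into [D]. Since 1 lies in [L M], which is generated
    by products of [I] and [M], evaluation at 0 writes 1 as a sum of products of [I] and this
    conductor. *)
Lemma normal_pair_const_invertible L M : normal_pair D D L M ->
  L = iota_int D (fun a => L (emb a)) -> invertible D (fun a => L (emb a)).
Proof.
move=> LM LE; set I := fun a => L (emb a) in LE *.
have [[[L0 LD] Lm] [_ Mm] LME [c [Dc c0 Lc]] [d [Dd d0 Md]]] := LM.
have LMR x y : L x -> M y -> IntR D (x * y).
  by move=> Lx My; rewrite -LME; apply: prodset_mem.
have Im : is_module D I.
  split=> [|a x Da Ix]; last by rewrite /I rmorphM; apply: Lm => //; apply: IntR_emb.
  by split; [rewrite /I rmorph0 | move=> x y Ix Iy; rewrite /I rmorphD; apply: LD].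
have [[I0 ID] IM] := Im; have [Dc' DM] := subring_module Dr.
pose I' x := forall a, I a -> D (a * x).
have I'd : I' d.
  by move=> a Ia; apply: IntR_emb_inv Dr _; rewrite rmorphM; apply: LMR.
have I'c : is_module D I'.
  split; first split.
  - by move=> a _; rewrite mulr0; case: Dc'.
  - by move=> x y Ix Iy a Ia; rewrite mulrDr; apply: Dc'.2; auto.
  - by move=> a x Da I'x b Ib; rewrite mulrCA; apply: DM => //; apply: I'x.
have [[I'0 I'D] I'M] := I'c.
split.
  split=> //; first by exists c; split=> //; apply/eqP.
  by exists d; split=> //; [apply/eqP | move=> x /I'd; rewrite mulrC].
exists I'; split.
  split=> //; first by exists d; split=> //; apply/eqP.
  by exists c; split=> //; [apply/eqP | move=> x; apply].
have II' : prodset I I' 1.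
  pose Q z := exists f : {poly K}, z = f%:F /\ prodset I I' f.[0].
  have Qc : add_closed Q.
    have [P0 PD] := prodset_add_closed I I'.
    split; first by exists 0; rewrite rmorph0 horner0.
    move=> _ _ [f [-> Pf]] [g [-> Pg]]; exists (f + g).
    by rewrite tofracD hornerD; split=> //; apply: PD.
  suff [f [/tofrac_inj <-]] : Q (emb 1) by rewrite hornerC.
  rewrite rmorph1; apply: (@prodset_ind _ L M) => //; last first.
    by rewrite LME; have [] := IntR_subring Dr.
  move=> x y + My; rewrite LE mulrC; move: x.
  apply: prodset_mul_closed => // _ g [a [Ia ->]] Dg.
  have My' : M (g * y) by apply: Mm.
  have [h hE] := normal_poly (normal_pairC LM) My'.
  exists (a%:P * h); rewrite tofracM -hE; split; first by ring.
  rewrite hornerM hornerC; apply: prodset_mem => // b Ib.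
  (* The polynomial [b h] is integer-valued, so its value at 0 shows that [h.[0]] lies in [I']. *)
  have := LMR _ _ Ib My'; rewrite hE -tofracM => /IntR_tofrac/(_ 0).
  by rewrite hornerM hornerC; apply; case: Dc'.
move=> x; split.
  by move: x; apply: prodset_ind => // a b Ia; apply.
move=> Dx; rewrite -[x]mulr1.
by have [_] := is_module_prod I I'c; apply.
Qed.

(* The ideal is [L :&: K] for a normal form [L] of [J]; it generates [L]
   because it does so locally. *)
Lemma in_im_iota_local J : invertible (IntR D) J ->
  (forall T, Theta T -> in_im_iota T (prodset J (IntR T))) -> in_im_iota D J.
Proof.
move=> /(invertible_normal_form Dqf DD)[u [L [M [u0 -> LM]]]] JT.
have [Lm _ LME [c [Dc c0 Lc]] _] := LM.
suff LE : L = iota_int D (fun a => L (emb a)).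
  exists (fun a => L (emb a)); split; last by apply/pic_eqP; exists u; rewrite -LE.
  exact: normal_pair_const_invertible LM LE.
set I := fun a => L (emb a).
apply: lsetP => z; split; last first.
  move: z; apply: prodset_ind; first by case: Lm.
  by move=> _ f [a [Ia ->]] Df; rewrite mulrC; apply: Lm.2.
move=> Lz; have iotam := IntR_module_embK DD (iota_int_module I Dr).
apply: (jaffard_descent Dqf Theta_jaffard iotam) => T TT.
have TD := over TT; have [Tr DT] := TD.
have [IT [[ITf _] /pic_eqP[v [v0 JTE]]]] := JT T TT.
have [w LTE] : exists w, prodset L (IntR T) = scale_set w (iota_int T IT).
  exists (u^-1 * v); rewrite -scale_scale_set -JTE scale_set_prod scale_scale_set.
  by rewrite (mulVf u0) scale1_set.
have R1 : IntR T 1 by have [] := IntR_subring Tr.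
have LT y : L y -> prodset L (IntR T) y.
  by move=> Ly; rewrite -[y]mulr1; apply: prodset_mem.
have LTpoly y : prodset L (IntR T) y -> exists f : {poly K}, y = f%:F.
  apply: (@prodset_ind _ _ _ (fun y => exists f : {poly K}, y = f%:F)).
    split; first by exists 0; rewrite rmorph0.
    by move=> _ _ [f ->] [g ->]; exists (f + g); rewrite tofracD.
  move=> x _ /(normal_poly LM)[f ->] [g [_ ->]].
  by exists (f * g); rewrite tofracM.
(* A nonzero constant multiple of [w] is a polynomial, and [w] divides the constant [c] of [L];
   hence [w] is constant. *)
have [k wE] : exists k, w = emb k.
  have [_ _ _ [a [ITa /eqP a0]] _] := ITf.
  have [p pE] : exists p : {poly K}, w * emb a = p%:F.
    apply: LTpoly; rewrite LTE; exists (emb a); split=> //.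
    exact: iota_int_emb.
  have := LT _ Lc; rewrite LTE => -[_ [/iota_int_tofrac[g ->]]] cE.
  have wE : w = (p * a^-1%:P)%:F.
    by rewrite tofracM -pE -mulrA -[_%:P%:F]/(emb _) -rmorphM divff // rmorph1 mulr1.
  move: cE; rewrite wE -tofracM => /tofrac_inj/(polyC_factor c0)[k ->].
  by exists k.
have := LT _ Lz; rewrite LTE => -[y [+ ->]]; move: y.
apply: prodset_mul_closed; first exact: loc_add_closed.
move=> _ f [a [ITa ->]] Tf; rewrite mulrA; apply: (loc_mul Dr TD); last first.
  exact: (loc_IntR Dqf Theta_jaffard).
have : prodset L (IntR T) (w * emb a).
  by rewrite LTE; exists (emb a); split=> //; apply: iota_int_emb.
rewrite (prodset_IntR Dqf Theta_jaffard) // wE.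
(* A multiplier bringing [k * a] into [L] brings it into the constants of [L], that is into [I]. *)
apply: covers_sub => b [Db Lb]; split=> //; exists (b * (k * a)).
by rewrite -[RHS]/(emb _) !rmorphM; split=> //; rewrite /I !rmorphM.
Qed.

Lemma extension_surjective (JT : lset K -> lset KX) :
  (forall T, Theta T -> invertible (IntR T) (JT T)) ->
  (exists s : list (lset K), forall T, Theta T ->
     ~ in_im_iota T (JT T) -> List.In T s) ->
  exists J, invertible (IntR D) J /\
    forall T, Theta T -> picInt_eq T (prodset J (IntR T)) (JT T).
Proof.
move=> JTi [s sP].
(* Trivial classes are represented by Int(T) itself, so the exceptional members all lie in [s];
   outside [Theta] the pair is a dummy. *)
have /choice[F FP] : forall T, exists p : lset KX * lset KX, Theta T ->
    normal_pair D T p.1 p.2 /\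
    ((in_im_iota T (JT T) /\ p = (IntR T, IntR T)) \/
     (~ in_im_iota T (JT T) /\ exists2 u, u != 0 & JT T = scale_set u p.1)).
  move=> T; have [TT|nT] := EM (Theta T); last by exists (IntR T, IntR T).
  have [imT|nim] := EM (in_im_iota T (JT T)).
    by exists (IntR T, IntR T) => _; split; [apply/normal_pair_IntR/over | left].
  have [u [L [M [u0 JE LM]]]] := invertible_normal_form Dqf (over TT) (JTi T TT).
  by exists (L, M) => _; split=> //; right; split=> //; exists u.
have Fout T : Theta T -> ~ List.In T s -> F T = (IntR T, IntR T).
  by move=> TT nTs; have [_ [[_ ->]//|[/(sP T TT)]]] := FP T TT.
pose F1 T := (F T).1; pose F2 T := (F T).2.
have F12 T : Theta T -> normal_pair D T (F1 T) (F2 T) by move=> /FP[].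
have F1m T : Theta T -> is_module (IntR T) (F1 T) by move=> /F12[].
have F2m T : Theta T -> is_module (IntR T) (F2 T) by move=> /F12[].
have F1c T : Theta T -> has_const D (F1 T) by move=> /F12[].
have F2c T : Theta T -> has_const D (F2 T) by move=> /F12[].
have F1p T z (TT : Theta T) := @normal_poly _ _ _ _ _ z (F12 T TT).
have F2p T z (TT : Theta T) := @normal_poly _ _ _ _ _ z (normal_pairC (F12 T TT)).
have F1o T : Theta T -> ~ List.In T s -> F1 T = IntR T.
  by move=> TT /(Fout T TT); rewrite /F1 => ->.
have F2o T : Theta T -> ~ List.In T s -> F2 T = IntR T.
  by move=> TT /(Fout T TT); rewrite /F2 => ->.
pose G1 := glue Theta F1; pose G2 := glue Theta F2.
have G1m : is_module (IntR D) G1 by exact: glue_module.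
have G2m : is_module (IntR D) G2 by exact: glue_module.
have locG1 T z : Theta T -> F1 T z -> loc D T G1 z.
  by move=> TT; apply: (loc_glue Dqf Theta_jaffard F1m F1c F1p F1o z TT).2.
have locG2 T z : Theta T -> F2 T z -> loc D T G2 z.
  by move=> TT; apply: (loc_glue Dqf Theta_jaffard F2m F2c F2p F2o z TT).2.
have G12m := is_module_prod G1 G2m.
have G12 : prodset G1 G2 = IntR D.
  apply: lsetP => z; split.
    move: z; apply: prodset_ind; first exact/subring_add_closed/IntR_subring.
    move=> x y G1x G2y; apply: (IntR_jaffard_bigcap Dqf Theta_jaffard) => T TT.
    by have [_ _ <- _ _] := F12 T TT; apply: prodset_mem; auto.
  (* It suffices that [G1 G2] contains 1, which is checked at each [T], where 1 lies in the product
     of [F1 T] and [F2 T]. *)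
  move=> Dz; rewrite -[z]mulr1; apply: G12m.2 => //.
  have G12mD := IntR_module_embK DD G12m.
  apply: (jaffard_descent Dqf Theta_jaffard G12mD) => T TT.
  have [Tr _] := over TT.
  have : prodset (F1 T) (F2 T) 1.
    by have [_ _ -> _ _] := F12 T TT; have [] := IntR_subring Tr.
  apply: (@prodset_ind _ _ _ (loc D T (prodset G1 G2))).
    by apply (loc_add_closed Dr (over TT) G12mD).
  by move=> x y /(locG1 T x TT) + /(locG2 T y TT); apply: loc_mul => //; apply: over.
exists G1; split.
  apply: (@normal_pair_invertible _ G1 G2) => //; split=> //.
    exact: (common_const Dqf Theta_jaffard F1m F1c F1o).
  exact: (common_const Dqf Theta_jaffard F2m F2c F2o).
move=> T TT; have [Tr _] := over TT; have Rm := subring_module (IntR_subring Tr).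
have -> : prodset G1 (IntR T) = F1 T.
  rewrite (prodset_IntR Dqf Theta_jaffard) //; apply: lsetP => z.
  exact: (loc_glue Dqf Theta_jaffard F1m F1c F1p F1o).
(* If the class is extended from [I], the comparing ideal is an inverse of [I]; otherwise [JT T] is
   a scaling of [F1 T] and the comparing ideal is [T]. *)
have [_ [[[I [Ii /pic_eqP[u [u0 JE]]]] FE]|[_ [u u0 JE]]]] := FP T TT.
  have [I' [I'i II']] := invertible_inverse Ii.
  exists I'; split=> //; apply/pic_eqP; exists u^-1; rewrite invr_eq0; split=> //.
  rewrite JE scale_set_prod iota_int_prod // II' iota_int_self //.
  by rewrite scale_scale_set mulVf // scale1_set /F1 FE.
exists T; split; first exact: invertible_self.
apply/pic_eqP; exists u^-1; rewrite invr_eq0; split=> //.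
have [_ R1 _ _] := IntR_subring Tr.
rewrite JE scale_set_prod iota_int_self // (prodset_module (F1m T TT)) //.
by rewrite scale_scale_set mulVf // scale1_set.
Qed.

End PicardSequence.

Theorem theorem4p7 (K : fieldType) (D : lset K) (Theta : lset K -> Prop) :
  domain_with_qf D -> jaffard D Theta ->
  [/\ (* 0 -> Pic(D) -> Pic(Int(D)) : iota_D is injective *)
      (forall I : lset K, invertible D I ->
         pic_eq (iota_int D I) (IntR D) -> pic_eq I D),
      (* the map [J] |-> ([J Int(T)])_T is well defined, into the direct sum *)
      (forall J, invertible (IntR D) J ->
         (forall T, Theta T -> invertible (IntR T) (prodset J (IntR T))) /\
         exists s : list (lset K), forall T, Theta T ->
           ~ in_im_iota T (prodset J (IntR T)) -> List.In T s),
      (* exactness at Pic(Int(D)) : kernel = image of iota_D *)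
      (forall J, invertible (IntR D) J ->
         (forall T, Theta T -> in_im_iota T (prodset J (IntR T))) <->
         in_im_iota D J) &
      (* surjectivity onto the direct sum of the Pic_Int(T) *)
      (forall JT : lset K -> lset {fraction {poly K}},
         (forall T, Theta T -> invertible (IntR T) (JT T)) ->
         (exists s : list (lset K), forall T, Theta T ->
            ~ in_im_iota T (JT T) -> List.In T s) ->
         exists J, invertible (IntR D) J /\
           forall T, Theta T -> picInt_eq T (prodset J (IntR T)) (JT T))].
Proof.
move=> Dqf ThetaJ; have Dr := Dqf.1; split.
- move=> I [If _]; apply: pic_eq_iota_int => //; first exact: frac_ideal_module If.
  by have [_ _ _ [a [Ia /eqP a0]] _] := If; exists a.
- move=> J Ji; split; last exact: extension_finite_support Ji.
  move=> T TT; have [Tr DT] := jaffard_overring ThetaJ TT.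
  apply: invertible_extend Ji; [exact: IntR_subring | exact: IntR_subring |].
  by move=> z; apply: (IntR_jaffard_sub Dqf ThetaJ).
- move=> J Ji; split; first exact: in_im_iota_local.
  by move=> JD T TT; apply: (in_im_iota_extend Dqf ThetaJ).
- exact: extension_surjective.
Qed.
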